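(* Let $p>0$, $\epsilon>0$, $0<\mu,\sigma\ll 1$, $\beta_1\in(0,1)$, and let $g_1,g_2,\dots$ be i.i.d. with $g_t\sim\mathrm{Unif}(\mu-\sigma,\mu+\sigma)$. Define $$u:=\lim_{t\to\infty}\lim_{\beta_2\to1}u_t,\qquad u_t=\frac{m_t}{\sqrt{v_t}+\epsilon},$$ where $m_t=\mathrm{EMA}_{\beta_1}(\{g_s^p\}_{s=1}^t)$ and $v_t=\mathrm{EMA}_{\beta_2}(\{(g_s^p)^2\}_{s=1}^t)$. In the low-noise regime $\sigma\ll\mu$, it holds that $$u=\frac{1+o(1)}{1+\frac{\epsilon}{\mu^p}}\quad\text{almost surely}.$$ Moreover, letting $\tilde u=\frac{1}{1+\frac{\epsilon}{\mu^p}}$, $\tilde u$ is monotonically decreasing with respect to $p$.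
   Context: For $g\in\mathbb{R}$ and $p>0$, $g^p$ denotes the sign-power $|g|^p\,\mathrm{sign}(g)$. For a sequence $\{a_s\}$ and $\beta\in(0,1)$, the exponential moving average is $\mathrm{EMA}_\beta(\{a_s\}_{s=1}^t)=\big(\sum_{s=1}^t\beta^{t-s}a_s\big)/\big(\sum_{s=1}^t\beta^{t-s}\big)$. $u_t$ is the update of the AdamWPower optimizer (AdamW, with zero weight decay, fed with the transformed gradients $g_t^p$) on a one-dimensional problem with stochastic gradients $g_t$; $\epsilon$ is Adam's numerical stability parameter. $o(1)$ denotes an infinitesimal quantity as $\sigma/\mu\to0$.
   Formalization: For fixed β1 and σ>0 the outer limit over t almost surely does not exist, since m_t keeps fluctuating; the claim is proved for both the liminf and the limsup over t of the limit of u_t as β2→1 (shown to exist for each t). *)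

(* Defs.v *)
From HB Require Import structures.
From mathcomp Require Export all_boot all_order all_algebra.
From mathcomp Require Export all_classical all_reals all_analysis.
Export Order.TTheory GRing.Theory Num.Theory.
Export numFieldNormedType.Exports.

Set Implicit Arguments.
Unset Strict Implicit.
Unset Printing Implicit Defensive.

Local Open Scope classical_set_scope.
Local Open Scope ring_scope.

Definition spow (R : realType) (x p : R) : R := `|x| `^ p * Num.sg x.

(** Sequences indexed by [1, 2, ...] are represented from index 0:
    [a s] is the term a_{s+1}, so its weight at time [t] is
    [beta ^+ (t - s.+1)].  At [t = 0] both sums are empty and the value is 0. *)
Definition ema (R : realType) (beta : R) (a : nat -> R) (t : nat) : R :=
  (\sum_(s < t) beta ^+ (t - s.+1)%N * a s) / (\sum_(s < t) beta ^+ (t - s.+1)%N).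

Definition adam_power (R : realType) (p eps beta1 beta2 : R) (g : nat -> R)
    (t : nat) : R :=
  ema beta1 (fun s => spow (g s) p) t /
  (Num.sqrt (ema beta2 (fun s => spow (g s) p ^+ 2) t) + eps).

(** [lim] is a total operator: this is the limit of u_t as beta2 tends to 1 from
    the left only when that limit exists. *)
Definition adam_power_lim (R : realType) (p eps beta1 : R) (g : nat -> R)
    (t : nat) : R :=
  lim (adam_power p eps beta1 b g t @[b --> (1 : R)^'-]).

Definition mutually_independent d (T : measurableType d) (R : realType)
    (P : probability T R) (g : nat -> {RV P >-> R}) : Prop :=
  forall (J : seq nat) (A : nat -> set R),
    uniq J -> (forall j, measurable (A j)) ->
    P (\big[setI/setT]_(j <- J) (g j @^-1` A j)) =
    (\prod_(j <- J) P (g j @^-1` A j))%E.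

Definition has_uniform_law d (T : measurableType d) (R : realType)
    (P : probability T R) (X : {RV P >-> R}) (a b : R) : Prop :=
  exists ab : a < b, forall A : set R, measurable A ->
    distribution P X A = uniform_prob ab A.

Definition iid_uniform d (T : measurableType d) (R : realType)
    (P : probability T R) (g : nat -> {RV P >-> R}) (a b : R) : Prop :=
  mutually_independent g /\ forall s, has_uniform_law (g s) a b.

Definition u_tilde (R : realType) (eps mu p : R) : R := 1 / (1 + eps / mu `^ p).

(* Main.v *)
(** The iterates are almost surely all within [sigma] of [mu], so every
    exponential moving average of their powers stays between
    [(mu - sigma)^p] and [(mu + sigma)^p]; as [sigma / mu] tends to 0 the ratio
    of these two bounds tends to 1. This squeezes [u_t] uniformly in [t], and
    no law of large numbers is needed. *)
Require Import Defs.
From mathcomp Require Import ring lra.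

Set Implicit Arguments.
Unset Strict Implicit.
Unset Printing Implicit Defensive.

Local Open Scope classical_set_scope.
Local Open Scope ring_scope.

Lemma spow_gt0 (R : realType) (x p : R) : 0 < x -> spow x p = x `^ p.
Proof. by move=> x0; rewrite /spow gtr0_norm// gtr0_sg// mulr1. Qed.

(** Split off the factor [a ^ (y - x)]: it is below 1 because powers with a positive exponent are
    increasing in the base and [a < 1]. *)
Lemma powR_ltr_exp (R : realType) (a x y : R) :
  0 < a < 1 -> x < y -> a `^ y < a `^ x.
Proof.
move=> /andP[a0 a1] xy.
have -> : y = x + (y - x) by rewrite addrC subrK.
rewrite powRD; last by rewrite (gt_eqF a0) implybT.
rewrite gtr_pMr ?powR_gt0//.
have yx : 0 < y - x by rewrite subr_gt0.
have := gt0_ltr_powR yx _ _ a1.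
by rewrite powR1; apply; rewrite nnegrE ?ltW.
Qed.

Lemma ema_weights_gt0 (R : realType) (beta : R) (t : nat) :
  0 < beta -> (0 < t)%N -> 0 < \sum_(s < t) beta ^+ (t - s.+1)%N.
Proof.
case: t => // t b0 _; rewrite big_ord_recl /=.
by rewrite ltr_pwDl ?exprn_gt0// sumr_ge0// => i _; rewrite exprn_ge0 ?ltW.
Qed.

Lemma ema_bounds (R : realType) (beta lo hi : R) (a : nat -> R) (t : nat) :
  0 < beta -> (0 < t)%N -> (forall s, lo <= a s <= hi) ->
  lo <= ema beta a t <= hi.
Proof.
move=> b0 t0 lohi; rewrite /ema.
have W0 := ema_weights_gt0 b0 t0.
rewrite ler_pdivlMr// ler_pdivrMr// !mulr_sumr.
apply/andP; split; apply: ler_sum => i _; have /andP[? ?] := lohi i.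
  by rewrite mulrC ler_wpM2l// exprn_ge0 ?ltW.
by rewrite [leRHS]mulrC ler_wpM2l// exprn_ge0 ?ltW.
Qed.

Lemma cvg_ema1 (R : realType) (a : nat -> R) (t : nat) :
  ema b a t @[b --> (1 : R)] --> ema 1 a t.
Proof.
have cpow n : b ^+ n @[b --> (1 : R)] --> (1 : R) ^+ n.
  exact: exprn_continuous.
(* At [t = 0] the sum of weights is 0, where inversion is not continuous; but there the average is
   constantly 0. *)
case: t => [|t].
  have ema0 b : ema b a 0 = 0 by rewrite /ema big_ord0 mul0r.
  by under eq_fun do rewrite ema0; rewrite ema0; exact: cvg_cst.
apply: cvgM.
  apply: cvg_big => [|i _]; first exact: add_continuous.
  by apply: cvgM; [exact: cpow | exact: cvg_cst].
apply: cvgV; first by rewrite gt_eqF ?ema_weights_gt0.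
by apply: cvg_big => [|i _]; [exact: add_continuous | exact: cpow].
Qed.

(** Since [eps > 0] keeps the denominator positive, [u_t] is continuous in [beta2] at 1. The inner
    limit is thus a substitution, which for [t > 0] turns the second average into the plain mean. *)
Lemma cvg_adam_power (R : realType) (p eps beta1 : R) (g : nat -> R) (t : nat) :
  0 < eps ->
  adam_power p eps beta1 b g t @[b --> (1 : R)^'-] -->
  adam_power p eps beta1 1 g t.
Proof.
move=> eps0; apply: cvg_at_left_filter.
apply: cvgM; first exact: cvg_cst.
apply: cvgV; first by rewrite gt_eqF// ltr_wpDl ?sqrtr_ge0.
apply: cvgD; last exact: cvg_cst.
by apply: continuous_cvg; [exact: sqrt_continuous | exact: cvg_ema1].
Qed.

Lemma adam_power_limE (R : realType) (p eps beta1 : R) (g : nat -> R) (t : nat) :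
  0 < eps ->
  adam_power_lim p eps beta1 g t = adam_power p eps beta1 1 g t.
Proof. by move=> eps0; apply: cvg_lim => //; exact: cvg_adam_power. Qed.

(** Meant for [M = mu ^ p], [m] the first average, [v] the root of the second, and [[a, b]] the
    range of the powers, with [K] bounding [b / a]. *)
Lemma quotient_bounds (R : realType) (eps K M a b m v : R) :
  0 < eps -> 0 < a -> a <= M <= b -> b <= K * a ->
  a <= m <= b -> a <= v <= b ->
  K^-1 / (1 + eps / M) <= m / (v + eps) <= K / (1 + eps / M).
Proof.
move=> e0 a0 /andP[aM Mb] bKa /andP[am mb] /andP[av vb].
have M0 : 0 < M by exact: lt_le_trans aM.
have b0 : 0 < b by exact: lt_le_trans Mb.
have K0 : 0 < K by rewrite -(pmulr_lgt0 _ a0); exact: lt_le_trans bKa.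
have D0 : 0 < 1 + eps / M by rewrite addr_gt0 ?divr_gt0.
have v0 : 0 < v + eps by rewrite addr_gt0// (lt_le_trans a0).
have -> : 1 + eps / M = (M + eps) / M by field; rewrite gt_eqF.
rewrite !invf_div.
have Me0 : 0 < M + eps by rewrite addr_gt0.
have bM : b * M <= K * a * M by rewrite ler_pM2r.
have be : b * eps <= K * a * eps by rewrite ler_pM2r.
apply/andP; split.
(* Cleared of denominators: [M (v + eps) <= b (M + eps) <= K a (M + eps) <= K m (M + eps)]. *)
- rewrite mulrA [K^-1 * M]mulrC -mulrA -invfM ler_pdivlMr// mulrAC.
  rewrite ler_pdivrMr ?mulr_gt0//.
  have : M * v <= M * b by rewrite ler_pM2l.
  have : M * eps <= b * eps by rewrite ler_pM2r.
  have : K * a * (M + eps) <= K * m * (M + eps).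
    by rewrite ler_pM2r// ler_pM2l.
  lra.
(* Here the chain is [m (M + eps) <= b (M + eps) <= K M (a + eps) <= K M (v + eps)]. *)
- rewrite mulrA ler_pdivrMr// mulrAC ler_pdivlMr//.
  have : K * a * eps <= K * M * eps by rewrite ler_pM2r// ler_pM2l.
  have : m * (M + eps) <= b * (M + eps) by rewrite ler_pM2r.
  have : K * M * (a + eps) <= K * M * (v + eps).
    by rewrite ler_pM2l ?lerD2r// mulr_gt0.
  lra.
Qed.

Lemma adam_power_bounds (R : realType) (p eps beta1 mu sigma K : R)
    (x : nat -> R) (t : nat) :
  0 < p -> 0 < eps -> 0 < beta1 -> 0 < sigma < mu ->
  (mu + sigma) `^ p <= K * (mu - sigma) `^ p ->
  (forall s, mu - sigma <= x s <= mu + sigma) -> (0 < t)%N ->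
  K^-1 / (1 + eps / mu `^ p) <= adam_power p eps beta1 1 x t
    <= K / (1 + eps / mu `^ p).
Proof.
move=> p0 e0 b0 /andP[s0 smu] bKa xb t0.
have lo0 : 0 < mu - sigma by rewrite subr_gt0.
have powle (y z : R) : 0 < y -> y <= z -> y `^ p <= z `^ p.
  by move=> y0 yz; apply: ge0_ler_powR; rewrite ?nnegrE; lra.
have spowb s : (mu - sigma) `^ p <= spow (x s) p <= (mu + sigma) `^ p.
  have /andP[lx xh] := xb s; have x0 := lt_le_trans lo0 lx.
  by rewrite spow_gt0// !powle.
have a0 : 0 < (mu - sigma) `^ p by rewrite powR_gt0.
apply: (@quotient_bounds _ _ _ _ ((mu - sigma) `^ p) ((mu + sigma) `^ p)) => //.
- by rewrite !powle//; lra.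
- exact: ema_bounds.
- have bb0 : 0 <= (mu + sigma) `^ p by exact: powR_ge0.
  have sqb s :
      (mu - sigma) `^ p ^+ 2 <= spow (x s) p ^+ 2 <= (mu + sigma) `^ p ^+ 2.
    have /andP[? ?] := spowb s.
    by apply/andP; split; rewrite ler_sqr ?nnegrE; lra.
  have /andP[lv vh] := ema_bounds ltr01 t0 sqb.
  (* Each bound becomes the root of its own square, so that monotonicity of the root applies. *)
  rewrite -(ger0_norm (ltW a0)) -(ger0_norm bb0) -!sqrtr_sqr.
  by apply/andP; split; exact: ler_wsqrtr.
Qed.

(** Index 0 is exempt because the empty average there is 0, outside the bounds. *)
Lemma limn_einf_esup_bounds (R : realType) (u : (\bar R)^nat) (lo hi : \bar R) :
  (forall n, (0 < n)%N -> (lo <= u n <= hi)%E) ->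
  (lo <= limn_einf u /\ limn_esup u <= hi)%E.
Proof.
move=> ub; rewrite limn_einf_lim limn_esup_lim; split.
  apply: lime_ge; first exact: is_cvg_einfs.
  exists 1%N => // n /= n0; apply: le_ereal_inf_tmp => _ [k /= nk <-].
  by have /andP[] := ub k (leq_trans n0 nk).
apply: lime_le; first exact: is_cvg_esups.
exists 1%N => // n /= n0; apply: ge_ereal_sup => _ [k /= nk <-].
by have /andP[] := ub k (leq_trans n0 nk).
Qed.

(** The exceptional set is the preimage of the complement of [[a, b]], over which the uniform
    density integrates to 0. *)
Lemma ae_uniform_in_itv d (T : measurableType d) (R : realType)
    (P : probability T R) (X : {RV P >-> R}) (a b : R) :
  has_uniform_law X a b -> {ae P, forall w, a <= X w <= b}.
Proof.
move=> [ab lawX]; exists (X @^-1` (~` `[a, b])); split.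
- rewrite -[_ @^-1` _]setTI; apply: measurable_funP => //.
  exact: measurableC.
- transitivity (distribution P X (~` `[a, b])) => //.
  rewrite lawX; last exact: measurableC.
  by rewrite /uniform_prob integral_uniform_pdf setICl integral_set0.
- by move=> w /= nab; rewrite in_itv.
Qed.

Lemma ratio_close (R : realType) (eta D x : R) :
  0 < eta -> 0 < D -> (1 + eta)^-1 / D <= x <= (1 + eta) / D ->
  exists2 e, `|e| <= eta & x = (1 + e) / D.
Proof.
move=> eta0 D0; rewrite ler_pdivrMr// ler_pdivlMr// => /andP[lx xh].
exists (x * D - 1); last by rewrite addrC subrK mulfK// gt_eqF.
rewrite ler_norml; apply/andP; split; last by lra.
(* This is [(1 - eta)(1 + eta) <= 1]. *)
have : 1 - eta <= (1 + eta)^-1.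
  by rewrite -[leRHS]mul1r ler_pdivlMr; nra.
lra.
Qed.

Lemma low_noise_radius (R : realType) (p eta : R) : 0 < p -> 0 < eta ->
  exists2 delta : R, 0 < delta &
    forall mu sigma : R, 0 < mu -> 0 < sigma -> sigma / mu < delta ->
    sigma < mu /\ (mu + sigma) `^ p <= (1 + eta) * (mu - sigma) `^ p.
Proof.
move=> p0 eta0; pose k := (1 + eta) `^ p^-1.
have kp : k `^ p = 1 + eta by rewrite -powRrM mulVf ?gt_eqF// powRr1//; lra.
have k1 : 1 < k.
  have pV0 : 0 < p^-1 by rewrite invr_gt0.
  rewrite -[ltLHS](congr1 (@^~ p^-1) (powR1 R)).
  by apply: gt0_ltr_powR; rewrite ?nnegrE; lra.
(* Solving [mu + sigma <= k (mu - sigma)] for [sigma / mu] gives this radius; raising to the power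
   [p] then yields the factor [k ^ p = 1 + eta]. *)
exists ((k - 1) / (k + 1)); first by rewrite divr_gt0; lra.
move=> mu sigma mu0 s0; rewrite ltr_pdivrMr// mulrAC ltr_pdivlMr; last by lra.
move=> sk.
have smu : sigma < mu by nra.
split=> //; rewrite -kp -powRM; [|lra|lra].
by apply: ge0_ler_powR; rewrite ?nnegrE; nra.
Qed.

(** With fixed [beta1] and non-degenerate noise the EMA of the numerator keeps
    fluctuating, so the outer limit over [t] does not exist almost surely.
    It is read as the lower and the upper limit, both of which are asserted to
    have the claimed form (hence so does the limit along any subsequence). *)
Theorem proposition5p2 (R : realType) (p eps beta1 : R)
    (p_gt0 : 0 < p) (eps_gt0 : 0 < eps) (beta1_01 : 0 < beta1 < 1) :
  (forall eta : R, 0 < eta -> exists2 delta : R, 0 < delta &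
    forall (mu sigma : R), 0 < mu < 1 -> 0 < sigma < 1 -> sigma / mu < delta ->
    forall (d : measure_display) (T : measurableType d) (P : probability T R)
      (g : nat -> {RV P >-> R}),
    iid_uniform g (mu - sigma) (mu + sigma) ->
    {ae P, forall w : T,
      (forall t : nat,
        cvg (adam_power p eps beta1 b (fun s => g s w) t @[b --> (1 : R)^'-])) /\
      exists e1 e2 : R, [/\ `|e1| <= eta, `|e2| <= eta,
        limn_einf (fun t => (adam_power_lim p eps beta1 (fun s => g s w) t)%:E) =
          ((1 + e1) / (1 + eps / mu `^ p))%:E &
        limn_esup (fun t => (adam_power_lim p eps beta1 (fun s => g s w) t)%:E) =
          ((1 + e2) / (1 + eps / mu `^ p))%:E]})
  /\
  (forall mu : R, 0 < mu < 1 -> forall p1 p2 : R, 0 < p1 -> p1 < p2 ->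
    u_tilde eps mu p2 < u_tilde eps mu p1).
Proof.
have /andP[b0 _] := beta1_01; split; last first.
  move=> mu mu01 p1 p2 _ p12; have /andP[mu0 _] := mu01.
  have D0 q : 0 < 1 + eps / mu `^ q by rewrite addr_gt0 ?divr_gt0 ?powR_gt0.
  rewrite /u_tilde ltr_pM2l// ltf_pV2 ?posrE// ltrD2l ltr_pM2l//.
  by rewrite ltf_pV2 ?posrE ?powR_gt0// powR_ltr_exp.
move=> eta eta0; have [delta delta0 Hdelta] := low_noise_radius p_gt0 eta0.
exists delta => // mu sigma /andP[mu0 _] /andP[s0 _] smudelta d T P g [_ law].
have [smu bKa] := Hdelta _ _ mu0 s0 smudelta.
have D0 : 0 < 1 + eps / mu `^ p by rewrite addr_gt0 ?divr_gt0 ?powR_gt0.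
(* A countable union of null sets is null, so one event serves all times. *)
have : {ae P, forall w, forall s, mu - sigma <= g s w <= mu + sigma}.
  by apply/ae_foralln => s; exact: ae_uniform_in_itv.
apply: filterS => w gw; split=> [t|].
  by apply/cvg_ex; eexists; exact: cvg_adam_power.
set u := fun t : nat => (_ t)%:E.
pose lo := (1 + eta)^-1 / (1 + eps / mu `^ p).
pose hi := (1 + eta) / (1 + eps / mu `^ p).
have [loinf suphi] : (lo%:E <= limn_einf u /\ limn_esup u <= hi%:E)%E.
  apply: limn_einf_esup_bounds => t t0; rewrite /u adam_power_limE// !lee_fin.
  by apply: (adam_power_bounds (sigma := sigma)) => //; exact/andP.
have infsup := limn_einf_sup u.
(* Finite bounds exclude infinite values of the lower and upper limits. *)
have close z : (lo%:E <= z <= hi%:E)%E ->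
    exists2 e, `|e| <= eta & z = ((1 + e) / (1 + eps / mu `^ p))%:E.
  case: z => [z||] /=; rewrite ?leNye ?leeNy_eq ?leye_eq ?andbF//.
  by rewrite !lee_fin => /(ratio_close eta0 D0)[e ? ->]; exists e.
have [e1 ? inf1] : exists2 e, `|e| <= eta &
    limn_einf u = ((1 + e) / (1 + eps / mu `^ p))%:E.
  by apply: close; rewrite loinf (le_trans infsup).
have [e2 ? sup2] : exists2 e, `|e| <= eta &
    limn_esup u = ((1 + e) / (1 + eps / mu `^ p))%:E.
  by apply: close; rewrite suphi (le_trans loinf).
by exists e1, e2.
Qed.
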